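(* The translation $(-)^\dagger$ of $\mathsf{TS4}$ into $\mathsf{MS4.t}$ is full and faithful; that is, for every formula $\varphi$ of $\mathcal{ML}$, $$\mathsf{TS4}\vdash\varphi\quad\text{iff}\quad\mathsf{MS4.t}\vdash\varphi^\dagger .$$
   Context: For a unary modality $\blacksquare$, the $\mathsf{S4}$-axioms are $\blacksquare(p\to q)\to(\blacksquare p\to\blacksquare q)$, $\blacksquare p\to p$, $\blacksquare p\to\blacksquare\blacksquare p$; the $\mathsf{S5}$-axioms for $\forall$ are the $\mathsf{S4}$-axioms for $\forall$ together with $p\to\forall\exists p$, where $\exists:=\neg\forall\neg$. **TS4.** $\mathcal{ML}$ is the classical propositional language with unary modalities $\Box,\blacksquare_F,\blacksquare_P$; $\Diamond:=\neg\Box\neg$. $\mathsf{TS4}$ is the least set of $\mathcal{ML}$-formulas containing all classical tautologies; the $\mathsf{S4}$-axioms for each of $\Box,\blacksquare_F,\blacksquare_P$; the tense axioms $p\to\blacksquare_P\neg\blacksquare_F\neg p$ and $p\to\blacksquare_F\neg\blacksquare_P\neg p$; the connecting axioms $\Diamond p\to\neg\blacksquare_F\neg p$ and $\neg\blacksquare_F\neg p\to\Diamond(\neg\blacksquare_F\neg p\wedge\neg\blacksquare_P\neg p)$; and closed under modus ponens, substitution, and necessitation for $\Box,\blacksquare_F,\blacksquare_P$. **MS4.t.** $\mathcal L_{T\forall}$ is the classical propositional language with unary modalities $\Box_F,\Box_P,\forall$; $\Diamond_F:=\neg\Box_F\neg$, $\Diamond_P:=\neg\Box_P\neg$, $\exists:=\neg\forall\neg$.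 $\mathsf{MS4.t}$ is the least set of $\mathcal L_{T\forall}$-formulas containing all classical tautologies, the $\mathsf{S4}$-axioms for $\Box_F$ and for $\Box_P$, the tense axioms $p\to\Box_P\Diamond_F p$ and $p\to\Box_F\Diamond_P p$, the $\mathsf{S5}$-axioms for $\forall$, the axiom $\Box_F\forall p\to\forall\Box_F p$, and closed under modus ponens, substitution, and necessitation for $\Box_F,\Box_P,\forall$. **Translation.** $(-)^\dagger$ maps $\mathcal{ML}$-formulas to $\mathcal L_{T\forall}$-formulas: $p^\dagger=p$ for each propositional letter $p$; $(-)^\dagger$ commutes with the boolean connectives; $(\Box\varphi)^\dagger=\Box_F\varphi^\dagger$; $(\blacksquare_F\varphi)^\dagger=\Box_F\forall\varphi^\dagger$; $(\blacksquare_P\varphi)^\dagger=\forall\Box_P\varphi^\dagger$. *)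

(* Defs.v *)
(* Propositional formulas over the letters [Var 0], [Var 1], ... with one unary
   connective [Mod m] for every [m : M]. *)
Inductive form (M : Type) : Type :=
| Var : nat -> form M
| Bot : form M
| Neg : form M -> form M
| And : form M -> form M -> form M
| Or  : form M -> form M -> form M
| Imp : form M -> form M -> form M
| Mod : M -> form M -> form M.

Arguments Var {M} _.
Arguments Bot {M}.
Arguments Neg {M} _.
Arguments And {M} _ _.
Arguments Or {M} _ _.
Arguments Imp {M} _ _.
Arguments Mod {M} _ _.

Definition dual {M : Type} (m : M) (A : form M) : form M := Neg (Mod m (Neg A)).

Fixpoint subst {M : Type} (s : nat -> form M) (A : form M) : form M :=
  match A with
  | Var n => s n
  | Bot => Bot
  | Neg B => Neg (subst s B)
  | And B C => And (subst s B) (subst s C)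
  | Or B C => Or (subst s B) (subst s C)
  | Imp B C => Imp (subst s B) (subst s C)
  | Mod m B => Mod m (subst s B)
  end.

(* Truth-table evaluation: letters and formulas of the form [Mod m B] are both
   treated as atoms, with values given by [v]. *)
Fixpoint eval {M : Type} (v : form M -> bool) (A : form M) : bool :=
  match A with
  | Var n => v (Var n)
  | Bot => false
  | Neg B => negb (eval v B)
  | And B C => andb (eval v B) (eval v C)
  | Or B C => orb (eval v B) (eval v C)
  | Imp B C => implb (eval v B) (eval v C)
  | Mod m B => v (Mod m B)
  end.

Definition tautology {M : Type} (A : form M) : Prop :=
  forall v : form M -> bool, eval v A = true.

(* The least set of formulas containing the tautologies and [Ax] and closed
   under modus ponens, substitution and necessitation for every modality. *)
Inductive logic {M : Type} (Ax : form M -> Prop) : form M -> Prop :=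
| logic_taut : forall A, tautology A -> logic Ax A
| logic_ax : forall A, Ax A -> logic Ax A
| logic_mp : forall A B, logic Ax (Imp A B) -> logic Ax A -> logic Ax B
| logic_subst : forall s A, logic Ax A -> logic Ax (subst s A)
| logic_nec : forall m A, logic Ax A -> logic Ax (Mod m A).

Inductive S4_ax {M : Type} (m : M) : form M -> Prop :=
| S4_K : S4_ax m (Imp (Mod m (Imp (Var 0) (Var 1)))
                      (Imp (Mod m (Var 0)) (Mod m (Var 1))))
| S4_T : S4_ax m (Imp (Mod m (Var 0)) (Var 0))
| S4_4 : S4_ax m (Imp (Mod m (Var 0)) (Mod m (Mod m (Var 0)))).

Inductive S5_ax {M : Type} (m : M) : form M -> Prop :=
| S5_S4 : forall A, S4_ax m A -> S5_ax m A
| S5_B : S5_ax m (Imp (Var 0) (Mod m (dual m (Var 0)))).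

Inductive tense_ax {M : Type} (f p : M) : form M -> Prop :=
| tense_PF : tense_ax f p (Imp (Var 0) (Mod p (dual f (Var 0))))
| tense_FP : tense_ax f p (Imp (Var 0) (Mod f (dual p (Var 0)))).

Inductive ts4_modality : Type := box | blackF | blackP.

Inductive TS4_ax : form ts4_modality -> Prop :=
| TS4_S4 : forall m A, S4_ax m A -> TS4_ax A
| TS4_tense : forall A, tense_ax blackF blackP A -> TS4_ax A
| TS4_dia : TS4_ax (Imp (dual box (Var 0)) (dual blackF (Var 0)))
| TS4_conn : TS4_ax (Imp (dual blackF (Var 0))
    (dual box (And (dual blackF (Var 0)) (dual blackP (Var 0))))).

Definition TS4 : form ts4_modality -> Prop := logic TS4_ax.

Inductive ms4t_modality : Type := boxF | boxP | univ.

Inductive MS4t_ax : form ms4t_modality -> Prop :=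
| MS4t_S4F : forall A, S4_ax boxF A -> MS4t_ax A
| MS4t_S4P : forall A, S4_ax boxP A -> MS4t_ax A
| MS4t_tense : forall A, tense_ax boxF boxP A -> MS4t_ax A
| MS4t_S5 : forall A, S5_ax univ A -> MS4t_ax A
| MS4t_comm : MS4t_ax (Imp (Mod boxF (Mod univ (Var 0)))
                           (Mod univ (Mod boxF (Var 0)))).

Definition MS4t : form ms4t_modality -> Prop := logic MS4t_ax.

Fixpoint dagger (A : form ts4_modality) : form ms4t_modality :=
  match A with
  | Var n => Var n
  | Bot => Bot
  | Neg B => Neg (dagger B)
  | And B C => And (dagger B) (dagger C)
  | Or B C => Or (dagger B) (dagger C)
  | Imp B C => Imp (dagger B) (dagger C)
  | Mod box B => Mod boxF (dagger B)
  | Mod blackF B => Mod boxF (Mod univ (dagger B))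
  | Mod blackP B => Mod univ (Mod boxP (dagger B))
  end.

(* Main.v *)
From Stdlib Require Import Classical ClassicalEpsilon Cantor.
Require Import Defs.

(** The translation reflects a passage between Kripke frames.  A TS4-frame
    carries a preorder [R] for [box] and a preorder [Q] for [blackF], with the
    converse of [Q] for [blackP], such that [R] is contained in [Q] and
    [x Q y] implies [x R z], [z Q y] and [y Q z] for some [z].  An MS4.t-frame
    carries a preorder [R] for [boxF], its converse for [boxP], and an
    equivalence [E] for [univ], such that [x E y R z] implies [x R u E z] for
    some [u].

    From an MS4.t-frame one gets a TS4-frame with the same [R] by taking for [Q]
    the composite of [R] and [E]; from a TS4-frame one gets an MS4.t-frame with
    the same [R] by taking for [E] the intersection of [Q] with its converse,
    and then [Q] is again the composite of [R] and [E].  Since [boxF univ]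
    quantifies over that composite and [univ boxP] over its converse, in both
    cases a formula is true at a point of the TS4-frame exactly when its
    translation is true there in the MS4.t-frame ([sat_dagger]).

    Hence it suffices that both logics are sound and complete for their frames.
    Completeness is shown with canonical models.  All the existential steps, in
    the truth lemma and in the two confluence conditions, come from the single
    lemma [canonical_exists]. *)

(** * Kripke semantics *)

(** Truth at the point [w] of the model with accessibility relations [R] and
    valuation [V]. *)
Fixpoint sat {M W : Type} (R : M -> W -> W -> Prop) (V : nat -> W -> Prop)
    (w : W) (A : form M) : Prop :=
  match A with
  | Var n => V n w
  | Bot => False
  | Neg B => ~ sat R V w B
  | And B C => sat R V w B /\ sat R V w C
  | Or B C => sat R V w B \/ sat R V w C
  | Imp B C => sat R V w B -> sat R V w C
  | Mod m B => forall u, R m w u -> sat R V u B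
  end.

(** Validity on a frame: truth at every point under every valuation. *)
Definition valid {M W : Type} (R : M -> W -> W -> Prop) (A : form M) : Prop :=
  forall V w, sat R V w A.

Lemma sat_dual {M W : Type} (R : M -> W -> W -> Prop) V w m A :
  sat R V w (dual m A) <-> exists u, R m w u /\ sat R V u A.
Proof.
  simpl. split.
  - intros H. apply NNPP. intros N. apply H. intros u Hu Hs.
    apply N. exists u. split; assumption.
  - intros [u [Hu Hs]] H. exact (H u Hu Hs).
Qed.

Lemma sat_subst {M W : Type} (R : M -> W -> W -> Prop) V s (A : form M) :
  forall w, sat R V w (subst s A) <-> sat R (fun n u => sat R V u (s n)) w A.
Proof.
  induction A; intros w; simpl; try tauto.
  - rewrite IHA. tauto.
  - rewrite IHA1, IHA2. tauto.
  - rewrite IHA1, IHA2. tauto.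
  - rewrite IHA1, IHA2. tauto.
  - split; intros H u Hu; apply IHA, H, Hu.
Qed.

Lemma valid_tautology {M W : Type} (R : M -> W -> W -> Prop) (A : form M) :
  tautology A -> valid R A.
Proof.
  intros T V w.
  set (v := fun B : form M =>
    if excluded_middle_informative (sat R V w B) then true else false).
  assert (E : forall B, eval v B = true <-> sat R V w B).
  { assert (Ev : forall B, v B = true <-> sat R V w B).
    { intros B. unfold v.
      destruct (excluded_middle_informative (sat R V w B)); split; intros;
        try assumption; try reflexivity; try discriminate; contradiction. }
    induction B; simpl;
      [ exact (Ev (Var n)) | split; [discriminate | tauto] | | | |
      | exact (Ev (Mod m B)) ].
    - rewrite <- IHB. destruct (eval v B); simpl;
        split; intros; try congruence; tauto.
    - rewrite <- IHB1, <- IHB2. destruct (eval v B1), (eval v B2); simpl;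
        split; intros; try tauto; intuition congruence.
    - rewrite <- IHB1, <- IHB2. destruct (eval v B1), (eval v B2); simpl;
        split; intros; try tauto; intuition congruence.
    - rewrite <- IHB1, <- IHB2. destruct (eval v B1), (eval v B2); simpl;
        split; intros; try tauto; intuition congruence. }
  apply E, T.
Qed.

Lemma soundness {M W : Type} (Ax : form M -> Prop) (R : M -> W -> W -> Prop) :
  (forall A, Ax A -> valid R A) -> forall A, logic Ax A -> valid R A.
Proof.
  intros HAx A H. induction H as [A H | A H | A B _ IH1 _ IH2 | s A _ IH | m A _ IH].
  - apply valid_tautology, H.
  - apply HAx, H.
  - intros V w. exact (IH1 V w (IH2 V w)).
  - intros V w. apply sat_subst, IH.
  - intros V w u _. apply IH.
Qed.

(** * Theories and Lindenbaum's lemma *)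

(** A theory contains the logic and is closed under modus ponens, but not
    necessarily under substitution or necessitation. *)
Definition theory {M : Type} (L : form M -> Prop) (T : form M -> Prop) : Prop :=
  (forall A, L A -> T A) /\ (forall A B, T (Imp A B) -> T A -> T B).

Ltac taut :=
  let v := fresh "v" in
  intros v; simpl;
  repeat match goal with
    | |- context [eval v ?A] => destruct (eval v A)
    | |- context [v ?A] => destruct (v A)
    end; reflexivity.

Section Theories.
Context {M : Type} {Ax : form M -> Prop}.
Let L := logic Ax.

Lemma theory_logic : theory L L.
Proof. split; [auto | exact (logic_mp Ax)]. Qed.

Lemma theory_taut T A : theory L T -> tautology A -> T A.
Proof. intros [H _] HA. apply H, logic_taut, HA. Qed.

Lemma theory_taut1 T A B : theory L T -> tautology (Imp A B) -> T A -> T B.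
Proof.
  intros HT H HA. apply (proj2 HT A); [apply theory_taut; assumption | assumption].
Qed.

Lemma theory_taut2 T A B C :
  theory L T -> tautology (Imp A (Imp B C)) -> T A -> T B -> T C.
Proof.
  intros HT H HA HB. apply (proj2 HT B); [| assumption].
  apply (theory_taut1 T A); assumption.
Qed.

Lemma theory_taut3 T A B C D :
  theory L T -> tautology (Imp A (Imp B (Imp C D))) -> T A -> T B -> T C -> T D.
Proof.
  intros HT H HA HB HC. apply (proj2 HT C); [| assumption].
  apply (theory_taut2 T A B); assumption.
Qed.

(** By the deduction theorem, this is the theory generated by [T] and [A]. *)
Lemma theory_extend T A : theory L T -> theory L (fun B => T (Imp A B)).
Proof.
  intros HT. split.
  - intros B HB. apply (theory_taut1 T B); [assumption | taut | apply (proj1 HT), HB].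
  - intros B C HBC HB.
    apply (theory_taut2 T _ _ _ HT) with (2 := HBC) (3 := HB). taut.
Qed.

(** Maximal consistent theories, the points of the canonical model. *)
Record world : Type := World {
  mem :> form M -> Prop;
  world_theory : theory L mem;
  world_proper : ~ mem Bot;
  world_complete : forall A, mem A \/ mem (Neg A) }.

Lemma world_neg (x : world) A : x (Neg A) <-> ~ x A.
Proof.
  split.
  - intros HN HA. apply (world_proper x).
    apply (theory_taut2 x (Neg A) A); try assumption; [apply world_theory | taut].
  - intros HA. destruct (world_complete x A); tauto.
Qed.

Lemma world_and (x : world) A B : x (And A B) <-> x A /\ x B.
Proof.
  pose proof (world_theory x) as HT. split.
  - intros H. split; apply (theory_taut1 x (And A B)); try assumption; taut.
  - intros [HA HB]. apply (theory_taut2 x A B); try assumption; taut.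
Qed.

Lemma world_or (x : world) A B : x (Or A B) <-> x A \/ x B.
Proof.
  pose proof (world_theory x) as HT. split.
  - intros H. destruct (world_complete x A) as [HA | HA]; [left; exact HA | right].
    apply (theory_taut2 x (Or A B) (Neg A)); try assumption; taut.
  - intros [H | H]; [apply (theory_taut1 x A) | apply (theory_taut1 x B)];
      try assumption; taut.
Qed.

Lemma world_imp (x : world) A B : x (Imp A B) <-> (x A -> x B).
Proof.
  pose proof (world_theory x) as HT. split; [apply (proj2 HT) |].
  intros H. destruct (world_complete x A) as [HA | HA].
  - apply (theory_taut1 x B); [assumption | taut | auto].
  - apply (theory_taut1 x (Neg A)); [assumption | taut | assumption].
Qed.

Lemma world_mp (x : world) A B : L (Imp A B) -> x A -> x B.
Proof. intros H. apply world_imp, (proj1 (world_theory x)), H. Qed.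

Lemma chain_le (T : nat -> form M -> Prop) :
  (forall n A, T n A -> T (S n) A) ->
  forall n m A, n <= m -> T n A -> T m A.
Proof. intros H n m A Hle HA. induction Hle; auto. Qed.

(** Every consistent theory is contained in a maximal consistent one.  The
    formulas are treated in the order of their codes: at stage [n] the theory is
    extended by the formula with code [n], if there is one and its negation has
    not been included. *)
Lemma lindenbaum (code : form M -> nat) (T : form M -> Prop) :
  (forall A B, code A = code B -> A = B) ->
  theory L T -> ~ T Bot -> exists x : world, forall A, T A -> x A.
Proof.
  intros inj HT HTB.
  set (step := fun n (U : form M -> Prop) B =>
    U B \/ exists A, code A = n /\ ~ U (Neg A) /\ U (Imp A B)).
  set (U := fix U n := match n with 0 => T | S k => step k (U k) end).
  assert (mono : forall n A, U n A -> U (S n) A) by (intros n A H; left; exact H).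
  assert (good : forall n, theory L (U n) /\ ~ U n Bot).
  { induction n as [| n [HU HB]]; [split; assumption |].
    split; [split |].
    - intros A HA. left. apply (proj1 HU), HA.
    - intros A B [H1 | [C [EC [NC H1]]]] [H2 | [D [ED [ND H2]]]].
      + left. exact (proj2 HU _ _ H1 H2).
      + right. exists D. split; [exact ED | split; [exact ND |]].
        apply (theory_taut2 (U n) _ _ _ HU) with (2 := H1) (3 := H2). taut.
      + right. exists C. split; [exact EC | split; [exact NC |]].
        apply (theory_taut2 (U n) _ _ _ HU) with (2 := H1) (3 := H2). taut.
      + assert (C = D) by (apply inj; congruence). subst D.
        right. exists C. split; [exact EC | split; [exact NC |]].
        exact (proj2 (theory_extend _ C HU) _ _ H1 H2).
    - intros [H | [A [_ [NA H]]]]; [exact (HB H) |].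
      apply NA. apply (theory_taut1 (U n) _ _ HU) with (2 := H). taut. }
  set (X := fun A => exists n, U n A).
  assert (HX : theory L X).
  { split.
    - intros A HA. exists 0. apply (proj1 HT), HA.
    - intros A B [n Hn] [m Hm]. exists (n + m).
      apply (proj2 (proj1 (good (n + m))) A).
      + apply (chain_le U mono n); [apply PeanoNat.Nat.le_add_r | exact Hn].
      + apply (chain_le U mono m); [apply PeanoNat.Nat.le_add_l | exact Hm]. }
  assert (HXB : ~ X Bot) by (intros [n Hn]; exact (proj2 (good n) Hn)).
  assert (HXC : forall A, X A \/ X (Neg A)).
  { intros A. destruct (classic (U (code A) (Neg A))) as [H | H].
    - right. exists (code A). exact H.
    - left. exists (S (code A)). right. exists A.
      split; [reflexivity | split; [exact H |]].
      apply theory_taut; [apply good | taut]. }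
  exists (World X HX HXB HXC). intros A HA. exists 0. exact HA.
Qed.

End Theories.
Arguments world {M} Ax.

(** A numbering of the formulas, injective whenever the numbering [c] of the
    modalities is. *)
Fixpoint code {M : Type} (c : M -> nat) (A : form M) : nat :=
  match A with
  | Var n => to_nat (0, n)
  | Bot => to_nat (1, 0)
  | Neg B => to_nat (2, code c B)
  | And B C => to_nat (3, to_nat (code c B, code c C))
  | Or B C => to_nat (4, to_nat (code c B, code c C))
  | Imp B C => to_nat (5, to_nat (code c B, code c C))
  | Mod m B => to_nat (6, to_nat (c m, code c B))
  end.

Arguments to_nat : simpl never.

Lemma to_nat_pair a b a' b' : to_nat (a, b) = to_nat (a', b') -> a = a' /\ b = b'.
Proof. intros H. apply to_nat_inj in H. injection H. auto. Qed.

Lemma code_inj {M : Type} (c : M -> nat) :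
  (forall m m', c m = c m' -> m = m') ->
  forall A B, code c A = code c B -> A = B.
Proof.
  intros inj A.
  induction A; intros B; destruct B; simpl; intros H;
    apply to_nat_pair in H; destruct H as [H0 H]; try discriminate H0;
    try (apply to_nat_pair in H; destruct H as [H H']);
    f_equal; auto.
Qed.

(** * Canonical models *)

(** Every modality of the logic satisfies the distribution axiom. *)
Definition normal {M : Type} (L : form M -> Prop) : Prop :=
  forall m A B, L (Imp (Mod m (Imp A B)) (Imp (Mod m A) (Mod m B))).

Section Canonical.
Context {M : Type} {Ax : form M -> Prop} (c : M -> nat).
Context (c_inj : forall m m', c m = c m' -> m = m').
Let L := logic Ax.
Context (HK : normal L).

(** The accessibility relations of the canonical frame, whose points are the
    maximal consistent theories. *)
Definition canonical (m : M) (x y : world Ax) : Prop :=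
  forall A, x (Mod m A) -> y A.

Lemma Mod_mono m A B : L (Imp A B) -> L (Imp (Mod m A) (Mod m B)).
Proof.
  intros H. apply (logic_mp Ax (Mod m (Imp A B))); [apply HK | apply logic_nec, H].
Qed.

Lemma dual_mono m A B : L (Imp A B) -> L (Imp (dual m A) (dual m B)).
Proof.
  intros H. assert (HN : L (Imp (Neg B) (Neg A))).
  { apply (theory_taut1 L _ _ theory_logic) with (2 := H). taut. }
  apply (theory_taut1 L _ _ theory_logic) with (2 := Mod_mono m _ _ HN). taut.
Qed.

Lemma world_dual (x : world Ax) m A : x (dual m A) <-> ~ x (Mod m (Neg A)).
Proof. apply world_neg. Qed.

Lemma canonical_dual m (x y : world Ax) :
  canonical m x y <-> forall A, y A -> x (dual m A).
Proof.
  split.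
  - intros H A HA. apply world_dual. intros HN.
    apply H, world_neg in HN. exact (HN HA).
  - intros H A HA. apply NNPP. intros HN. apply world_neg in HN.
    specialize (H _ HN). apply world_dual in H. apply H.
    revert HA. apply world_mp, Mod_mono, logic_taut. taut.
Qed.

(** The existence lemma, in a form that lets the successor [z] be related to a
    second point [y]: with [f A] a conjunction of diamonds of [A], the last conclusion
    says that [z] sees [y] along the corresponding relations.  A constant [f] gives
    the usual existence lemma. *)
Lemma canonical_exists (f : form M -> form M) m (x y : world Ax) :
  (forall A B, L (Imp A B) -> L (Imp (f A) (f B))) ->
  (forall A, y A -> x (dual m (f A))) ->
  exists z : world Ax, canonical m x z /\ forall A, y A -> z (f A).
Proof.
  intros f_mono H.
  (* The consequences of the [A] with [Mod m A] in [x] and the [f A] with [A] in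
     [y]: as [y] is closed under conjunction and [f] is monotone, a single [f A]
     is enough. *)
  set (T := fun B => exists A, y A /\ x (Mod m (Imp (f A) B))).
  pose (top := Imp (@Bot M) Bot).
  assert (Htop : y top) by (apply (theory_taut _ _ (world_theory y)); taut).
  assert (HT : theory L T).
  { split.
    - intros A HA. exists top. split; [exact Htop |].
      apply (proj1 (world_theory x)), logic_nec.
      apply (theory_taut1 L _ _ theory_logic) with (2 := HA). taut.
    - intros B C [A1 [H1 HBC]] [A2 [H2 HB]]. exists (And A1 A2).
      split; [apply world_and; split; assumption |].
      assert (L1 : L (Imp (f (And A1 A2)) (f A1))) by (apply f_mono, logic_taut; taut).
      assert (L2 : L (Imp (f (And A1 A2)) (f A2))) by (apply f_mono, logic_taut; taut).
      assert (E : x (Imp (Mod m (Imp (f A2) B)) (Mod m (Imp (f (And A1 A2)) C)))).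
      { apply (world_mp x) with (1 := HK _ _ _). revert HBC.
        apply world_mp, Mod_mono.
        apply (theory_taut2 L _ _ _ theory_logic) with (2 := L1) (3 := L2). taut. }
      exact (proj1 (world_imp x _ _) E HB). }
  assert (HB : ~ T Bot).
  { intros [A [HA HN]]. specialize (H A HA). apply world_dual in H. apply H.
    revert HN. apply world_mp, Mod_mono, logic_taut. taut. }
  destruct (lindenbaum (code c) T (code_inj c c_inj) HT HB) as [z Hz].
  exists z. split.
  - intros A HA. apply Hz. exists top. split; [exact Htop |].
    revert HA. apply world_mp, Mod_mono, logic_taut. taut.
  - intros A HA. apply Hz. exists A. split; [exact HA |].
    apply (proj1 (world_theory x)), logic_nec, logic_taut. taut.
Qed.

(** The truth lemma. *)
Lemma canonical_sat (A : form M) :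
  forall x : world Ax, sat canonical (fun n y => y (Var n)) x A <-> x A.
Proof.
  induction A; intros x; simpl.
  - tauto.
  - split; [tauto | apply world_proper].
  - rewrite IHA, world_neg. tauto.
  - rewrite IHA1, IHA2, world_and. tauto.
  - rewrite IHA1, IHA2, world_or. tauto.
  - rewrite IHA1, IHA2, world_imp. tauto.
  - split.
    + intros H. apply NNPP. intros HN.
      destruct (canonical_exists (fun _ => Neg A) m x x) as [z [Hz HzA]].
      * intros _ _ _. apply logic_taut. taut.
      * intros _ _. apply world_dual. intros HA. apply HN. revert HA.
        apply world_mp, Mod_mono, logic_taut. taut.
      * assert (HzN : z (Neg A)).
        { apply (HzA (Imp Bot Bot)), (theory_taut _ _ (world_theory x)). taut. }
        apply world_neg in HzN. apply HzN, IHA, H, Hz.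
    + intros H u Hu. apply IHA, Hu, H.
Qed.

Lemma canonical_complete (A : form M) : valid canonical A -> L A.
Proof.
  intros H. apply NNPP. intros HN.
  destruct (lindenbaum (Ax := Ax) (code c) (fun B => L (Imp (Neg A) B))
    (code_inj c c_inj)) as [x Hx].
  - apply theory_extend, theory_logic.
  - intros HB. apply HN. apply (theory_taut1 L _ _ theory_logic) with (2 := HB). taut.
  - apply (world_neg x A).
    + apply Hx, logic_taut. taut.
    + apply canonical_sat, H.
Qed.

Lemma canonical_refl m :
  (forall A, L (Imp (Mod m A) A)) -> forall x, canonical m x x.
Proof. intros H x A. apply world_mp, H. Qed.

Lemma canonical_trans m :
  (forall A, L (Imp (Mod m A) (Mod m (Mod m A)))) ->
  forall x y z, canonical m x y -> canonical m y z -> canonical m x z.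
Proof. intros H x y z Hxy Hyz A HA. apply Hyz, Hxy. revert HA. apply world_mp, H. Qed.

Lemma canonical_converse m m' :
  (forall A, L (Imp A (Mod m (dual m' A)))) ->
  forall x y, canonical m x y -> canonical m' y x.
Proof.
  intros H x y Hxy. apply canonical_dual. intros A HA. apply Hxy.
  revert HA. apply world_mp, H.
Qed.

End Canonical.

(** * Soundness and completeness of the two logics *)

(** Uniform instances of an axiom in the letters [Var 0] and [Var 1]. *)
Lemma logic_instance {M : Type} (Ax : form M -> Prop) (X A B : form M) :
  Ax X -> logic Ax (subst (fun n => match n with 0 => A | _ => B end) X).
Proof. intros H. apply logic_subst, logic_ax, H. Qed.

Definition preorder {W : Type} (R : W -> W -> Prop) : Prop :=
  (forall x, R x x) /\ (forall x y z, R x y -> R y z -> R x z).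

Lemma valid_S4 {M W : Type} (R : M -> W -> W -> Prop) m A :
  preorder (R m) -> S4_ax m A -> valid R A.
Proof.
  intros [refl trans] H V w. destruct H; simpl.
  - intros H1 H2 u Hu. exact (H1 u Hu (H2 u Hu)).
  - intros H. apply H, refl.
  - intros H u Hu v Hv. apply H, (trans w u v Hu Hv).
Qed.

Lemma valid_converse {M W : Type} (R : M -> W -> W -> Prop) m m' n :
  (forall x y, R m x y -> R m' y x) ->
  valid R (Imp (Var n) (Mod m (dual m' (Var n)))).
Proof.
  intros H V w Hw u Hu. apply sat_dual. exists w. split; [apply H, Hu | exact Hw].
Qed.

Lemma canonical_preorder {M : Type} (Ax : form M -> Prop) m :
  (forall A, S4_ax m A -> Ax A) -> preorder (canonical (Ax := Ax) m).
Proof.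
  intros H. split.
  - apply canonical_refl. intros A. exact (logic_instance Ax _ A A (H _ (S4_T m))).
  - apply canonical_trans. intros A. exact (logic_instance Ax _ A A (H _ (S4_4 m))).
Qed.

(** The frames of TS4, with [R box] and [R blackF] as the two basic relations. *)
Record TS4_frame {W : Type} (R : ts4_modality -> W -> W -> Prop) : Prop := {
  ts4_preorder : forall m, preorder (R m);
  ts4_converse : forall x y, R blackP x y <-> R blackF y x;
  ts4_incl : forall x y, R box x y -> R blackF x y;
  ts4_conn : forall x y, R blackF x y ->
    exists z, R box x z /\ R blackF z y /\ R blackF y z }.

(** The frames of MS4.t, with [R boxF] and [R univ] as the two basic relations. *)
Record MS4t_frame {W : Type} (R : ms4t_modality -> W -> W -> Prop) : Prop := {
  ms4t_preorder : forall m, preorder (R m);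
  ms4t_converse : forall x y, R boxP x y <-> R boxF y x;
  ms4t_sym : forall x y, R univ x y -> R univ y x;
  ms4t_comm : forall x y z, R univ x y -> R boxF y z ->
    exists u, R boxF x u /\ R univ u z }.

Lemma TS4_sound {W : Type} (R : ts4_modality -> W -> W -> Prop) A :
  TS4_frame R -> TS4 A -> valid R A.
Proof.
  intros [pre conv incl conn]. apply soundness. intros X HX.
  destruct HX as [m X HX | X HX | |].
  - exact (valid_S4 R m X (pre m) HX).
  - destruct HX; apply valid_converse; intros x y; apply conv.
  - intros V w Hw. apply sat_dual in Hw. destruct Hw as [u [Hu Hs]].
    apply sat_dual. exists u. split; [apply incl, Hu | exact Hs].
  - intros V w Hw. apply sat_dual in Hw. destruct Hw as [u [Hu Hs]].
    destruct (conn w u Hu) as [z [Hz [Hzu Huz]]].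
    apply sat_dual. exists z. split; [exact Hz |].
    split; apply sat_dual; exists u; split; try exact Hs; [exact Hzu |].
    apply conv, Huz.
Qed.

Lemma MS4t_sound {W : Type} (R : ms4t_modality -> W -> W -> Prop) A :
  MS4t_frame R -> MS4t A -> valid R A.
Proof.
  intros [pre conv sym comm]. apply soundness. intros X HX.
  destruct HX as [X HX | X HX | X HX | X HX |].
  - exact (valid_S4 R boxF X (pre boxF) HX).
  - exact (valid_S4 R boxP X (pre boxP) HX).
  - destruct HX; apply valid_converse; intros x y; apply conv.
  - destruct HX as [X HX |]; [exact (valid_S4 R univ X (pre univ) HX) |].
    apply valid_converse, sym.
  - intros V w H y Hy z Hz. destruct (comm w y z Hy Hz) as [u [Hu Huz]].
    exact (H u Hu z Huz).
Qed.

Lemma TS4_normal : normal TS4.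
Proof. intros m A B. exact (logic_instance TS4_ax _ A B (TS4_S4 m _ (S4_K m))). Qed.

Definition ts4_code (m : ts4_modality) : nat :=
  match m with box => 0 | blackF => 1 | blackP => 2 end.

Lemma ts4_code_inj m m' : ts4_code m = ts4_code m' -> m = m'.
Proof. destruct m, m'; simpl; congruence. Qed.

Lemma canonical_TS4 : TS4_frame (canonical (Ax := TS4_ax)).
Proof.
  assert (conv : forall x y : world TS4_ax,
            canonical blackP x y <-> canonical blackF y x).
  { intros x y. split; apply (canonical_converse TS4_normal); intros A.
    - exact (logic_instance TS4_ax _ A A (TS4_tense _ (tense_PF _ _))).
    - exact (logic_instance TS4_ax _ A A (TS4_tense _ (tense_FP _ _))). }
  split.
  - intros m. apply canonical_preorder, TS4_S4.
  - exact conv.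
  - intros x y H. apply (canonical_dual TS4_normal). intros A HA.
    apply (world_mp x (dual box A)).
    + exact (logic_instance TS4_ax _ A A TS4_dia).
    + revert A HA. apply (canonical_dual TS4_normal), H.
  - intros x y H.
    destruct (canonical_exists ts4_code ts4_code_inj TS4_normal
      (fun A => And (dual blackF A) (dual blackP A)) box x y) as [z [Hxz Hz]].
    + intros A B HAB.
      apply (theory_taut2 TS4 _ _ _ theory_logic)
        with (2 := dual_mono TS4_normal blackF A B HAB)
             (3 := dual_mono TS4_normal blackP A B HAB).
      taut.
    + intros A HA. apply (world_mp x (dual blackF A)).
      * exact (logic_instance TS4_ax _ A A TS4_conn).
      * revert A HA. apply (canonical_dual TS4_normal), H.
    + exists z. split; [exact Hxz | split; [| apply conv]];
        apply (canonical_dual TS4_normal); intros A HA;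
        apply Hz, world_and in HA; apply HA.
Qed.

Lemma MS4t_S4 m A : S4_ax m A -> MS4t_ax A.
Proof.
  destruct m; [apply MS4t_S4F | apply MS4t_S4P |].
  intros H. apply MS4t_S5, S5_S4, H.
Qed.

Lemma MS4t_normal : normal MS4t.
Proof. intros m A B. exact (logic_instance MS4t_ax _ A B (MS4t_S4 m _ (S4_K m))). Qed.

Definition ms4t_code (m : ms4t_modality) : nat :=
  match m with boxF => 0 | boxP => 1 | univ => 2 end.

Lemma ms4t_code_inj m m' : ms4t_code m = ms4t_code m' -> m = m'.
Proof. destruct m, m'; simpl; congruence. Qed.

Lemma canonical_MS4t : MS4t_frame (canonical (Ax := MS4t_ax)).
Proof.
  split.
  - intros m. apply canonical_preorder, MS4t_S4.
  - intros x y. split; apply (canonical_converse MS4t_normal); intros A.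
    + exact (logic_instance MS4t_ax _ A A (MS4t_tense _ (tense_PF _ _))).
    + exact (logic_instance MS4t_ax _ A A (MS4t_tense _ (tense_FP _ _))).
  - apply (canonical_converse MS4t_normal). intros A.
    exact (logic_instance MS4t_ax _ A A (MS4t_S5 _ (S5_B _))).
  - intros x y z Hxy Hyz.
    destruct (canonical_exists ms4t_code ms4t_code_inj MS4t_normal
      (dual univ) boxF x z) as [u [Hxu Hu]].
    + apply (dual_mono MS4t_normal).
    + intros A HA. apply world_dual. intros HN.
      assert (Hx : x (Mod boxF (Mod univ (Neg A)))).
      { revert HN. apply world_mp, (Mod_mono MS4t_normal), logic_taut. taut. }
      apply (world_mp x _ (Mod univ (Mod boxF (Neg A)))) in Hx.
      * apply Hxy, Hyz, world_neg in Hx. exact (Hx HA).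
      * exact (logic_instance MS4t_ax _ (Neg A) A MS4t_comm).
    + exists u. split; [exact Hxu |]. apply (canonical_dual MS4t_normal), Hu.
Qed.

(** * The correspondence of frames *)

(** Preservation of truth, for a frame [R] of the language of TS4 and a frame [S]
    of the language of MS4.t whose relations match along the clauses of
    [dagger]. *)
Lemma sat_dagger {W : Type} (R : ts4_modality -> W -> W -> Prop)
    (S : ms4t_modality -> W -> W -> Prop) :
  (forall x y, R box x y <-> S boxF x y) ->
  (forall x y, R blackF x y <-> exists z, S boxF x z /\ S univ z y) ->
  (forall x y, R blackP x y <-> exists z, S univ x z /\ S boxP z y) ->
  forall V A w, sat S V w (dagger A) <-> sat R V w A.
Proof.
  intros Hbox HF HP V A. induction A as [n | | B IH | B IHB C IHC | B IHB C IHC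
    | B IHB C IHC | m B IH]; intros w; simpl; try tauto.
  - rewrite IH. tauto.
  - rewrite IHB, IHC. tauto.
  - rewrite IHB, IHC. tauto.
  - rewrite IHB, IHC. tauto.
  - destruct m; simpl; split.
    + intros H u Hu. apply IH, H, Hbox, Hu.
    + intros H u Hu. apply IH, H, Hbox, Hu.
    + intros H u Hu. apply HF in Hu. destruct Hu as [z [Hz Hzu]].
      exact (proj1 (IH u) (H z Hz u Hzu)).
    + intros H z Hz u Hzu. apply IH, H, HF. exists z. split; assumption.
    + intros H u Hu. apply HP in Hu. destruct Hu as [z [Hz Hzu]].
      exact (proj1 (IH u) (H z Hz u Hzu)).
    + intros H z Hz u Hzu. apply IH, H, HP. exists z. split; assumption.
Qed.

(** The TS4-frame of an MS4.t-frame. *)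
Definition ts4_of_ms4t {W : Type} (S : ms4t_modality -> W -> W -> Prop)
    (m : ts4_modality) (x y : W) : Prop :=
  match m with
  | box => S boxF x y
  | blackF => exists z, S boxF x z /\ S univ z y
  | blackP => exists z, S univ x z /\ S boxP z y
  end.

Lemma ts4_of_ms4t_frame {W : Type} (S : ms4t_modality -> W -> W -> Prop) :
  MS4t_frame S -> TS4_frame (ts4_of_ms4t S).
Proof.
  intros [pre conv sym comm].
  assert (convQ : forall x y, ts4_of_ms4t S blackP x y <-> ts4_of_ms4t S blackF y x).
  { intros x y. split; intros [z [H1 H2]]; exists z; split;
      try (apply conv; assumption); apply sym; assumption. }
  destruct (pre boxF) as [reflF transF]. destruct (pre univ) as [reflE transE].
  assert (preQ : preorder (ts4_of_ms4t S blackF)).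
  { split.
    - intros x. exists x. split; [apply reflF | apply reflE].
    - intros x y z [u [Hxu Huy]] [v [Hyv Hvz]].
      destruct (comm u y v Huy Hyv) as [t [Hut Htv]]. exists t.
      split; [exact (transF x u t Hxu Hut) | exact (transE t v z Htv Hvz)]. }
  split.
  - intros m. destruct m; [exact (pre boxF) | exact preQ |].
    split.
    + intros x. apply convQ, preQ.
    + intros x y z Hxy Hyz. apply convQ. apply convQ in Hxy, Hyz.
      exact (proj2 preQ z y x Hyz Hxy).
  - exact convQ.
  - intros x y H. exists y. split; [exact H | apply reflE].
  - intros x y [z [Hxz Hzy]]. exists z. split; [exact Hxz |].
    split; [exists z | exists y]; split; auto.
Qed.

(** The MS4.t-frame of a TS4-frame. *)
Definition ms4t_of_ts4 {W : Type} (R : ts4_modality -> W -> W -> Prop)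
    (m : ms4t_modality) (x y : W) : Prop :=
  match m with
  | boxF => R box x y
  | boxP => R box y x
  | univ => R blackF x y /\ R blackF y x
  end.

(** The composite of the relations of [boxF] and [univ] gives back that of
    [blackF]. *)
Lemma ms4t_of_ts4_comp {W : Type} (R : ts4_modality -> W -> W -> Prop) x y :
  TS4_frame R ->
  R blackF x y <-> exists z, ms4t_of_ts4 R boxF x z /\ ms4t_of_ts4 R univ z y.
Proof.
  intros [pre conv incl conn]. split.
  - apply conn.
  - intros [z [Hxz [Hzy _]]]. exact (proj2 (pre blackF) x z y (incl x z Hxz) Hzy).
Qed.

Lemma ms4t_of_ts4_frame {W : Type} (R : ts4_modality -> W -> W -> Prop) :
  TS4_frame R -> MS4t_frame (ms4t_of_ts4 R).
Proof.
  intros HR. destruct (ts4_preorder R HR box) as [reflR transR].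
  destruct (ts4_preorder R HR blackF) as [reflQ transQ].
  split.
  - intros m. destruct m.
    + exact (ts4_preorder R HR box).
    + split; [exact reflR |]. intros x y z H1 H2. exact (transR z y x H2 H1).
    + split; [intros x; split; apply reflQ |].
      intros x y z [H1 H2] [H3 H4]. split; eauto.
  - intros x y. simpl. tauto.
  - intros x y. simpl. tauto.
  - intros x y z [Hxy _] Hyz. apply (ms4t_of_ts4_comp R x z HR).
    exact (transQ x y z Hxy (ts4_incl R HR y z Hyz)).
Qed.

Theorem theorem4p16 (phi : form ts4_modality) : TS4 phi <-> MS4t (dagger phi).
Proof.
  split; intros H.
  - apply (canonical_complete ms4t_code ms4t_code_inj MS4t_normal).
    intros V w. apply (sat_dagger (ts4_of_ms4t canonical)); try (simpl; tauto).
    apply TS4_sound; [| exact H]. apply ts4_of_ms4t_frame, canonical_MS4t.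
  - apply (canonical_complete ts4_code ts4_code_inj TS4_normal).
    pose proof canonical_TS4 as HF.
    intros V w. apply (sat_dagger canonical (ms4t_of_ts4 canonical)).
    + simpl. tauto.
    + intros x y. apply ms4t_of_ts4_comp, HF.
    + intros x y. rewrite (ts4_converse _ HF), (ms4t_of_ts4_comp canonical y x HF).
      simpl. split; intros [z Hz]; exists z; tauto.
    + apply MS4t_sound; [| exact H]. apply ms4t_of_ts4_frame, HF.
Qed.
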